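(* For all $m\ge0$, (i) $\displaystyle \mathfrak E_{[2m+1];1}(x)=\frac12\left(\frac1{U_{2m+1}^2\left(\frac1{2\sqrt x}\right)}+\frac{x}{U_m^2\left(\frac1{2x}\right)}\right)$; (ii) $\displaystyle \mathfrak O_{[2m+1];1}(x)=\frac12\left(\frac1{U_{2m+1}^2\left(\frac1{2\sqrt x}\right)}-\frac{x}{U_m^2\left(\frac1{2x}\right)}\right)$; (iii) $\displaystyle \mathfrak E_{[2m+2];1}(x)=\frac12\left(\frac1{U_{2m+2}^2\left(\frac1{2\sqrt x}\right)}+\frac{x^2R_{m+1}^2(x^2)}{(1+x^2R_{m+1}^2(x^2))^2U_m^2\left(\frac1{2x}\right)}\bigl(1+2xR_{m+1}(x^2)-x^2R_{m+1}^2(x^2)\bigr)\right)$; (iv) $\displaystyle \mathfrak O_{[2m+2];1}(x)=\frac12\left(\frac1{U_{2m+2}^2\left(\frac1{2\sqrt x}\right)}-\frac{x^2R_{m+1}^2(x^2)}{(1+x^2R_{m+1}^2(x^2))^2U_m^2\left(\frac1{2x}\right)}\bigl(1+2xR_{m+1}(x^2)-x^2R_{m+1}^2(x^2)\bigr)\right)$.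
   Context: $\mathfrak S_n$ is the set of permutations of $\{1,\dots,n\}$. An occurrence of a pattern $\tau\in\mathfrak S_k$ in $\pi$ is a choice of positions $i_1<\dots<i_k$ such that $(\pi_{i_1},\dots,\pi_{i_k})$ is order-isomorphic to $\tau$; $\pi$ avoids $\tau$ if there is none, and contains $\tau$ exactly $r$ times if there are exactly $r$ occurrences. $[k]$ denotes the pattern $12\ldots k$. $\mathfrak E_{\tau;1}(x)$ (resp. $\mathfrak O_{\tau;1}(x)$) is the ordinary generating function in $n$ for the number of even (resp. odd) $132$-avoiding permutations in $\mathfrak S_n$ that contain $\tau$ exactly once. $U_r$ is the Chebyshev polynomial of the second kind: $U_0(t)=1$, $U_1(t)=2t$, $U_r(t)=2tU_{r-1}(t)-U_{r-2}(t)$; $U_r^2(t)=(U_r(t))^2$. For $k\ge1$, $R_k(x)=\dfrac{U_{k-1}\left(\frac1{2\sqrt x}\right)}{\sqrt x\,U_k\left(\frac1{2\sqrt x}\right)}$, a rational function of $x$ (so $R_1(x)=1$, $R_k(x)=1/(1-xR_{k-1}(x))$ for $k\ge2$), and $R_k^2(x^2)=(R_k(x^2))^2$. *)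

(* Defs.v *)
From HB Require Import structures.
From mathcomp Require Import all_boot all_order all_fingroup all_algebra.
From mathcomp Require Import boolp.

Set Implicit Arguments.
Unset Strict Implicit.
Unset Printing Implicit Defensive.

Import GRing.Theory.
Local Open Scope ring_scope.

(** * Formal power series *)

Record fps (R : Type) := Fps { fps_coef :> nat -> R }.
Arguments Fps {R}.

Lemma fpsP (R : Type) (f g : fps R) : f =1 g -> f = g.
Proof. by case: f g => [f] [g] /= /funext ->. Qed.

HB.instance Definition _ (R : Type) := gen_eqMixin (fps R).
HB.instance Definition _ (R : Type) := gen_choiceMixin (fps R).

Section FpsRing.
Variable R : idomainType.
Implicit Types f g h : fps R.

Definition fps_zero : fps R := Fps (fun=> 0).
Definition fps_opp f : fps R := Fps (fun n => - f n).
Definition fps_add f g : fps R := Fps (fun n => f n + g n).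
Definition fps_one : fps R := Fps (fun n => (n == 0)%:R).
Definition fps_mul f g : fps R :=
  Fps (fun n => \sum_(i < n.+1) f i * g (n - i)%N).

Lemma fps_addA : associative fps_add.
Proof. by move=> f g h; apply: fpsP => n /=; rewrite addrA. Qed.
Lemma fps_addC : commutative fps_add.
Proof. by move=> f g; apply: fpsP => n /=; rewrite addrC. Qed.
Lemma fps_add0 : left_id fps_zero fps_add.
Proof. by move=> f; apply: fpsP => n /=; rewrite add0r. Qed.
Lemma fps_addN : left_inverse fps_zero fps_opp fps_add.
Proof. by move=> f; apply: fpsP => n /=; rewrite addNr. Qed.

HB.instance Definition _ :=
  GRing.isZmodule.Build (fps R) fps_addA fps_addC fps_add0 fps_addN.

Definition fps_trunc N f : {poly R} := \poly_(i < N) f i.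

Lemma fps_mul_trunc N f g n : (n < N)%N ->
  fps_mul f g n = (fps_trunc N f * fps_trunc N g)`_n.
Proof.
move=> ltnN; rewrite coefM /=; apply: eq_bigr => i _.
rewrite !coef_poly (leq_ltn_trans (leq_subr _ _) ltnN).
by rewrite (leq_ltn_trans _ ltnN) // -ltnS.
Qed.

Lemma fps_mulC : commutative fps_mul.
Proof.
by move=> f g; apply: fpsP => n; rewrite !(@fps_mul_trunc n.+1) // mulrC.
Qed.

Lemma fps_mulA : associative fps_mul.
Proof.
move=> f g h; apply: fpsP => n; pose T := fps_trunc n.+1.
transitivity ((T f * (T g * T h))`_n); last rewrite mulrA; rewrite coefM;
  apply: eq_bigr => i _; congr (_ * _).
- by rewrite coef_poly ltn_ord.
- by rewrite -fps_mul_trunc // ltnS leq_subr.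
- by rewrite -fps_mul_trunc.
- by rewrite coef_poly ltnS leq_subr.
Qed.

Lemma fps_mul1 : left_id fps_one fps_mul.
Proof.
move=> f; apply: fpsP => n /=; rewrite big_ord_recl /= mul1r subn0.
by rewrite big1 ?addr0 // => i _; rewrite mul0r.
Qed.

Lemma fps_mulDl : left_distributive fps_mul fps_add.
Proof.
move=> f g h; apply: fpsP => n /=; rewrite -big_split /=.
by apply: eq_bigr => i _; rewrite mulrDl.
Qed.

Lemma fps_one_neq0 : fps_one != fps_zero.
Proof.
by apply/eqP => /(congr1 (fun f : fps R => f 0)) /= /eqP; rewrite oner_eq0.
Qed.

HB.instance Definition _ := GRing.Zmodule_isComNzRing.Build (fps R)
  fps_mulA fps_mulC fps_mul1 fps_mulDl fps_one_neq0.

Definition fps_unit : {pred fps R} := fun f => `[< exists g, g * f = 1 >].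
Definition fps_inv f : fps R :=
  if pselect (exists g, g * f = 1) is left ex_g then projT1 (cid ex_g) else f.

Lemma fps_mulVr : {in fps_unit, left_inverse 1 fps_inv *%R}.
Proof.
move=> f /asboolP uf; rewrite /fps_inv.
by case: pselect => // ex_g; case: (cid ex_g).
Qed.
Lemma fps_unitPl f g : g * f = 1 -> fps_unit f.
Proof. by move=> gf1; apply/asboolP; exists g. Qed.
Lemma fps_inv_out : {in [predC fps_unit], fps_inv =1 id}.
Proof.
move=> f /negP nuf; rewrite /fps_inv; case: pselect => // ex_g.
by case: nuf; apply/asboolP.
Qed.

HB.instance Definition _ := GRing.ComNzRing_hasMulInverse.Build (fps R)
  fps_mulVr fps_unitPl fps_inv_out.

Lemma fps_lead f : f != 0 ->
  exists2 n, f n != 0 & forall i, (i < n)%N -> f i = 0.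
Proof.
move=> f0; have ex_n : exists n, f n != 0.
  apply: contrapT => noex; case/eqP: f0; apply: fpsP => n.
  by apply/eqP/negPn/negP => fn; apply: noex; exists n.
exists (ex_minn ex_n); case: ex_minnP => // n _ minn_n i ltin.
by apply/eqP/negPn/negP => /minn_n; rewrite leqNgt ltin.
Qed.

Lemma fps_idomain : GRing.integral_domain_axiom (fps R).
Proof.
move=> f g fg0; apply/norP => -[/fps_lead[a fa lta] /fps_lead[b gb ltb]].
have: (f * g) (a + b)%N = f a * g b.
  have lt_a : (a < (a + b).+1)%N by rewrite ltnS leq_addr.
  rewrite [LHS](bigD1 (Ordinal lt_a)) //= addKn big1 ?addr0 // => i ne_ia.
  case: (ltngtP i a) => [/lta->|ltai|eq_ia]; first by rewrite mul0r.
    rewrite [g _]ltb ?mulr0 // ltn_subLR ?ltn_add2r //.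
    by rewrite -ltnS ltn_ord.
  by case/eqP: ne_ia; apply: val_inj.
by rewrite fg0 => /esym/eqP; rewrite mulf_eq0 (negPf fa) (negPf gb).
Qed.

HB.instance Definition _ :=
  GRing.ComUnitRing_isIntegral.Build (fps R) fps_idomain.

Definition fps_X : fps R := Fps (fun n => (n == 1)%:R).

(* f(y) |-> f(y^2) *)
Definition fps_sq f : fps R := Fps (fun n => if odd n then 0 else f n./2).

End FpsRing.

(** * The field in which the generating functions live

   The identities involve both x and the square root of x. They are stated in
   the field Q((y)) of fractions of Q[[y]], with y playing the role of sqrt x,
   so that x is y^2 and a series F(x) is identified with F(y^2). *)

Definition laurent : fieldType := {fraction (fps rat)}.

Definition sqrtx : laurent := tofrac (fps_X rat).
Definition varx : laurent := sqrtx ^+ 2.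

Definition ogf (a : nat -> nat) : fps rat := Fps (fun n => (a n)%:R).
Definition at_x (F : fps rat) : laurent := tofrac (fps_sq F).

(** * Chebyshev polynomials of the second kind *)

Fixpoint chebU (F : fieldType) (r : nat) : {poly F} :=
  match r with
  | 0 => 1
  | 1 => 2 *: 'X
  | (r'.+1 as s).+1 => 2 *: 'X * chebU F s - chebU F r'
  end.

Definition Uval (F : fieldType) (r : nat) (t : F) : F := (chebU F r).[t].

(* The argument s is a square root of the argument of R_k:
   chebR k s = R_k(s^2); in particular R_k(x^2) is chebR k x. *)
Definition chebR (F : fieldType) (k : nat) (s : F) : F :=
  Uval k.-1 (1 / (2 * s)) / (s * Uval k (1 / (2 * s))).

(** * Pattern occurrences *)

(* An occurrence is given by the increasing map a |-> i_a of positions. *)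
Definition occurrences (k n : nat) (tau : 'S_k) (pi : 'S_n) :
    {set {ffun 'I_k -> 'I_n}} :=
  [set i : {ffun 'I_k -> 'I_n} |
    [forall a : 'I_k, forall b : 'I_k, (a < b)%N ==> (i a < i b)%N] &&
    [forall a : 'I_k, forall b : 'I_k, (pi (i a) < pi (i b))%N == (tau a < tau b)%N]].

Definition avoids (k n : nat) (tau : 'S_k) (pi : 'S_n) : bool :=
  occurrences tau pi == set0.

Definition contains_exactly (r k n : nat) (tau : 'S_k) (pi : 'S_n) : bool :=
  #|occurrences tau pi| == r.

(* Values are shifted to start at 0: one-line notation 0 2 1. *)
Definition pat132 : 'S_3 := tperm (inord 1) (inord 2).

Definition increasing (k : nat) : 'S_k := 1%g.

Definition even_count (k : nat) (tau : 'S_k) (r n : nat) : nat :=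
  #|[set pi : 'S_n |
      [&& ~~ odd_perm pi, avoids pat132 pi & contains_exactly r tau pi]]|.

Definition odd_count (k : nat) (tau : 'S_k) (r n : nat) : nat :=
  #|[set pi : 'S_n |
      [&& odd_perm pi, avoids pat132 pi & contains_exactly r tau pi]]|.

Definition even_gf (k : nat) (tau : 'S_k) (r : nat) : fps rat :=
  ogf (even_count tau r).

Definition odd_gf (k : nat) (tau : 'S_k) (r : nat) : fps rat :=
  ogf (odd_count tau r).

(* Main.v *)
Require Import Defs.
From mathcomp Require Import all_boot all_order all_fingroup all_algebra.
From mathcomp Require Import zify ring.

Set Implicit Arguments.
Unset Strict Implicit.
Unset Printing Implicit Defensive.

Import GRing.Theory.

(** A 132-avoiding permutation of size n+1 with maximum in position j+1 is
    [L' n R] where every entry of [L'] exceeds every entry of [R], so it is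
    determined by two 132-avoiding permutations [L] and [R] of sizes j and n-j
    ([Av132_skew], [sum_Av132]).  Two statistics follow this decomposition.

    - Call an increasing subsequence of length k a k-chain.  A chain lies in [L],
      or in [R], or is one of [L] followed by the maximum.  Hence there is no
      (k+1)-chain exactly when [L] has no k-chain and [R] no (k+1)-chain; and
      there is exactly one (k+1)-chain (k > 0) exactly when either [L] has one
      k-chain and [R] no (k+1)-chain, or [L] has no k-chain and [R] has one
      (k+1)-chain, because a (k+1)-chain contains at least two k-chains
      ([chains_gt1]).
    - The number of inversions is inv L + inv R + (j+1)(n-j), so the sign is the
      product of the signs of [L] and [R], times -1 when j is even and n-j is odd.

    Write a_k and b_k for the generating functions of the 132-avoiding
    permutations without a k-chain, respectively with exactly one.  Without signs,
    a_(k+1) = 1 + x a_k a_(k+1) and b_(k+1) = x (b_k a_(k+1) + a_k b_(k+1)),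
    which give a_k = R_k and b_k = 1 / U_k^2 ([Uval_ratio], [unsigned_once]).

    With signs, split a_k = E + O and b_k = P + Q into even and odd powers of x.
    With a formal square root i of -1, alpha_k = E + i O and beta_k = P + i Q, the
    recurrences read (1 - x O_k - i x E_k) alpha_(k+1) = 1 and
    beta_(k+1) = i x alpha_(k+1)^2 conj(beta_k).  Starting from k = 1 one finds
    alpha_(2m+1) = 1 + i x R_m(x^2) and
    alpha_(2m+2) = R_(m+1)(x^2) / (1 - i x R_(m+1)(x^2)), whence
    beta_(2m+3) = x^2 R_(m+1)(x^2)^2 beta_(2m+1), i.e.
    beta_(2m+1) = i x / U_m(1/(2x))^2, and one more step gives beta_(2m+2).  The
    proof carries out this computation on real and imaginary parts
    ([avoid_odd], [avoid_even], [once_step_even], [once_step_odd]).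

    The even and odd counts are half the sum and half the difference of the
    unsigned and signed counts ([even_odd_gf]). *)

(** * Permutations as words *)

Fixpoint subseqs (T : Type) (s : seq T) : seq (seq T) :=
  if s is x :: t then map (cons x) (subseqs t) ++ subseqs t else [:: [::]].

Lemma mem_subseqs (T : eqType) (s u : seq T) :
  (u \in subseqs s) = subseq u s.
Proof.
elim: s u => [|x s IHs] u; first by rewrite inE; case: u.
rewrite mem_cat IHs; case: u => [|y u]; first by rewrite !sub0seq orbT.
rewrite /=; case: (eqVneq y x) => [->|ne_yx].
  rewrite mem_map ?IHs; last by move=> ? ? [].
  by apply/orb_idr; apply: subseq_trans; apply: subseq_cons.
apply/orb_idl => /mapP[v _ [eq_yx _]].
by rewrite eq_yx eqxx in ne_yx.
Qed.

Lemma subseqs_uniq (T : eqType) (s : seq T) : uniq s -> uniq (subseqs s).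
Proof.
elim: s => //= x s IHs /andP[nsx /IHs{}IHs].
rewrite cat_uniq map_inj_uniq ?IHs /= ?andbT; last by move=> ? ? [].
apply/hasPn => u; rewrite mem_subseqs => /mem_subseq us.
apply/mapP => -[v _ def_u]; case/negP: nsx; apply: us.
by rewrite def_u mem_head.
Qed.

Lemma sorted_subseq_enum_ord n (p : seq 'I_n) :
  sorted (fun a b : 'I_n => a < b) p -> subseq p (enum 'I_n).
Proof.
have ltT : transitive (fun a b : 'I_n => a < b) by move=> ? ? ?; apply: ltn_trans.
move=> sp; have -> : p = [seq a <- enum 'I_n | a \in p].
  apply: (irr_sorted_eq ltT) => //; first by move=> ?; apply: ltnn.
    apply: sorted_filter => //.
    by have := iota_ltn_sorted 0 n; rewrite -val_enum_ord sorted_map.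
  by move=> a; rewrite mem_filter mem_enum inE andbT.
exact: filter_subseq.
Qed.

Definition word {n} (pi : 'S_n) : seq nat := [seq val (pi i) | i <- enum 'I_n].

Lemma perm_word n (pi : 'S_n) : perm_eq (word pi) (iota 0 n).
Proof.
rewrite -val_enum_ord /word (map_comp val pi); apply: perm_map.
apply: uniq_perm; first by rewrite (map_inj_uniq perm_inj) enum_uniq.
  exact: enum_uniq.
move=> i; rewrite mem_enum; apply/mapP; exists ((pi^-1)%g i).
  by rewrite mem_enum.
by rewrite permKV.
Qed.

Lemma word_inj n : injective (@word n).
Proof.
move=> p q eq_pq; apply/permP => i; apply: val_inj.
by move/eq_in_map: eq_pq => /(_ i); apply; rewrite mem_enum.
Qed.

Lemma card_words n (P : pred (seq nat)) :
  #|[set pi : 'S_n | P (word pi)]| = count P (permutations (iota 0 n)).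
Proof.
have eq_w : perm_eq [seq word pi | pi <- enum {: 'S_n}] (permutations (iota 0 n)).
  have uw : uniq [seq word pi | pi <- enum {: 'S_n}].
    by rewrite map_inj_uniq ?enum_uniq //; apply: word_inj.
  apply: uniq_perm => //; first exact: permutations_uniq.
  apply: (uniq_min_size uw _ _).2 => [w /mapP[pi _ ->]|].
    by rewrite mem_permutations perm_word.
  by rewrite size_permutations ?iota_uniq // size_iota size_map -cardE card_Sn.
rewrite -(seq.permP eq_w) count_map -sum1_card -sum1_count [RHS]big_enum_cond /=.
by apply: eq_bigl => pi; rewrite inE.
Qed.

Definition matches {k} (tau : 'S_k) (u : seq nat) : bool :=
  (size u == k) &&
  [forall a : 'I_k, forall b : 'I_k, (nth 0 u a < nth 0 u b) == (tau a < tau b)].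

(** The positions of an occurrence are determined by the values read there, so
    occurrences can be counted as subsequences of the one-line notation, on which
    recursion over the word is possible. *)
Lemma card_occurrences k n (tau : 'S_k) (pi : 'S_n) :
  #|occurrences tau pi| = count (matches tau) (subseqs (word pi)).
Proof.
pose v (i : {ffun 'I_k -> 'I_n}) := [seq val (pi (i a)) | a <- enum 'I_k].
have nth_v i (a : 'I_k) : nth 0 (v i) a = pi (i a).
  by rewrite (nth_map a) ?nth_ord_enum // size_enum_ord.
have v_inj : injective v.
  move=> i j eq_ij; apply/ffunP => a; apply: (@perm_inj _ pi); apply: val_inj.
  by rewrite /= -!nth_v eq_ij.
have uw : uniq (word pi) by rewrite (perm_uniq (perm_word pi)) iota_uniq.
rewrite cardE -(size_map v) -size_filter; apply/perm_size/uniq_perm.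
- by rewrite map_inj_uniq ?enum_uniq.
- exact/filter_uniq/subseqs_uniq.
move=> u; rewrite mem_filter mem_subseqs.
apply/mapP/andP => [[i] | [/andP[/eqP sz_u /forallP mu] /subseqP[mk sz_mk def_u]]].
  rewrite mem_enum inE => /andP[/forallP inc_i /forallP mi] ->; split.
    rewrite /matches size_map size_enum_ord eqxx; apply/forallP => a.
    by apply/forallP => b; rewrite !nth_v; apply: (forallP (mi a)).
  rewrite /v (map_comp (val \o pi) i); apply: map_subseq.
  apply: sorted_subseq_enum_ord; rewrite sorted_map.
  have := iota_ltn_sorted 0 k; rewrite -val_enum_ord sorted_map.
  apply: sub_sorted => a b /= lt_ab.
  exact: (implyP (forallP (inc_i a) b)).
have [p sp def_p] : exists2 p : seq 'I_n, sorted (fun a b : 'I_n => a < b) p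
    & u = [seq val (pi i) | i <- p].
  exists (mask mk (enum 'I_n)); last by rewrite def_u -map_mask.
  apply: sorted_mask; first by move=> ? ? ?; apply: ltn_trans.
  by have := iota_ltn_sorted 0 n; rewrite -val_enum_ord sorted_map.
have sz_p : size p == k by rewrite -sz_u def_p size_map.
pose i := [ffun a => tnth (Tuple sz_p) a].
have def_v : u = v i.
  apply: (@eq_from_nth _ 0) => [|a lt_ak]; first by rewrite sz_u size_map size_enum_ord.
  rewrite sz_u in lt_ak; rewrite -[a]/(val (Ordinal lt_ak)) nth_v ffunE def_p.
  rewrite (nth_map (tnth (Tuple sz_p) (Ordinal lt_ak))) ?(eqP sz_p) //.
  by rewrite [in RHS](tnth_nth (tnth (Tuple sz_p) (Ordinal lt_ak))).
exists i => //; rewrite mem_enum inE; apply/andP; split; apply/forallP => a.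
  apply/forallP => b; apply/implyP => lt_ab; rewrite !ffunE.
  have x0 : 'I_n by exact: (i a).
  rewrite !(tnth_nth x0) /=.
  apply: (sorted_ltn_nth (leT := fun a b : 'I_n => a < b)) => //.
  - by move=> ? ? ?; apply: ltn_trans.
  - by rewrite inE (eqP sz_p).
  - by rewrite inE (eqP sz_p).
by apply/forallP => b; rewrite -!nth_v -def_v; apply: (forallP (mu a)).
Qed.

Fixpoint inversions (w : seq nat) : nat :=
  if w is x :: t then count (fun y => y < x) t + inversions t else 0.

Lemma inversions_homo (f : nat -> nat) w :
  {mono f : x y / x < y} -> inversions (map f w) = inversions w.
Proof.
move=> f_mono; elim: w => //= x w ->; rewrite count_map; congr (_ + _).
by apply: eq_count => y /=; rewrite f_mono.
Qed.

Lemma word_lift_perm n j (pi : 'S_n) :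
  word (lift_perm ord0 j pi) = val j :: map (bump j) (word pi).
Proof.
rewrite /word enum_ordSl /= lift_perm_id -!map_comp; congr (_ :: _).
by apply: eq_map => i /=; rewrite lift_perm_lift.
Qed.

Lemma lift_perm_surj n (pi : 'S_n.+1) :
  exists j, exists pi' : 'S_n, pi = lift_perm ord0 j pi'.
Proof.
pose j := pi ord0.
have ne i : j != pi (lift ord0 i) by rewrite (inj_eq perm_inj) neq_lift.
pose f i := s2val (unlift_some (ne i)).
have fE i : pi (lift ord0 i) = lift j (f i) by rewrite /f; case: unlift_some.
have f_inj : injective f.
  move=> a b eq_f; apply: (@lift_inj _ ord0); apply: (@perm_inj _ pi).
  by rewrite !fE eq_f.
exists j, (perm f_inj); apply/permP => i.
case: (unliftP ord0 i) => [i' ->|->]; last by rewrite lift_perm_id.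
by rewrite lift_perm_lift permE fE.
Qed.

Lemma count_ltn_iota j n : j <= n -> count (fun y => y < j) (iota 0 n) = j.
Proof.
move=> le_jn; rewrite -(subnKC le_jn) iotaD count_cat add0n.
rewrite (@eq_in_count _ _ predT (iota 0 j)) => [|y]; last by rewrite mem_iota.
rewrite count_predT size_iota (@eq_in_count _ _ pred0) ?count_pred0 ?addn0 //.
by move=> y; rewrite mem_iota => /andP[le_jy _]; rewrite ltnNge le_jy.
Qed.

(** Removing the first letter j of a permutation removes j inversions, and this
    agrees with the parity of [lift_perm]. *)
Lemma odd_perm_inversions n (pi : 'S_n) : odd_perm pi = odd (inversions (word pi)).
Proof.
elim: n => [|n IHn] in pi *.
  by rewrite permS0 odd_perm1 /word enum_ord0.
have [j [pi' ->]] := lift_perm_surj pi; rewrite word_lift_perm odd_lift_perm /=.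
rewrite inversions_homo; last by move=> x y; rewrite /bump; lia.
rewrite oddD -IHn; congr (odd _ (+) _); rewrite count_map.
rewrite -[LHS](@count_ltn_iota j n) ?leq_ord // -(seq.permP (perm_word pi')).
by apply: eq_count => y /=; rewrite /bump; lia.
Qed.

Lemma matches_increasing k u :
  matches (increasing k) u = (size u == k) && sorted ltn u.
Proof.
have perm1E (a : 'I_k) : increasing k a = a by rewrite perm1.
rewrite /matches; case: eqP => //= sz_u; apply/forallP/idP => [mu | su a].
  apply/(sortedP 0) => i lt_i; rewrite sz_u in lt_i.
  have := forallP (mu (Ordinal (ltnW lt_i))) (Ordinal lt_i).
  by rewrite !perm1E /= ltnSn => /eqP.
have inc_u i j : j < k -> i < j -> nth 0 u i < nth 0 u j.
  by move=> ltjk ltij; apply: (sorted_ltn_nth ltn_trans); rewrite ?inE ?sz_u //; lia.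
apply/forallP => b; rewrite !perm1E /=; have /= [lta ltb] := (ltn_ord a, ltn_ord b).
case: (ltngtP a b) => [/inc_u-> //|/inc_u lt_ba|->]; last by rewrite ltnn.
by rewrite ltnNge ltnW ?lt_ba.
Qed.

Lemma matches_pat132 u :
  matches pat132 u = if u is [:: a; b; c] then a < c < b else false.
Proof.
have E0 : pat132 ord0 = ord0 by rewrite tpermD // -val_eqE /= !inordK.
have E1 : pat132 (inord 1) = inord 2 by rewrite tpermL.
have E2 : pat132 (inord 2) = inord 1 by rewrite tpermR.
case: u => [|a [|b [|c [|? ?]]]] //; rewrite /matches /=.
apply/forallP/idP => [mu | /andP[ltac ltcb] i].
  have := forallP (mu ord0) (inord 2); have := forallP (mu (inord 2)) (inord 1).
  by rewrite E0 E1 E2 /= !inordK //= => /eqP-> /eqP->.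
have ordE (j : 'I_3) : [\/ j = ord0, j = inord 1 | j = inord 2].
  case: j => [[|[|[|//]]] lt_j]; [constructor 1 | constructor 2 | constructor 3];
  by apply: val_inj; rewrite /= ?inordK.
apply/forallP => j.
by case: (ordE i) => ->; case: (ordE j) => ->; rewrite ?E0 ?E1 ?E2 /= ?inordK //=; lia.
Qed.

(** The number of increasing subsequences of length [k] with all entries at
    least [lo] (see [chains_subseqs]); the bound [lo] is what makes the recursion
    on the word structural. *)
Fixpoint chains (lo k : nat) (w : seq nat) : nat :=
  if k is k'.+1 then
    if w is x :: t then chains lo k t + (lo <= x) * chains x.+1 k' t else 0
  else 1.

Lemma chains0 lo w : chains lo 0 w = 1.
Proof. by case: w. Qed.

Lemma chains_subseqs lo k w :
  chains lo k w =
  count (fun u => [&& size u == k, sorted ltn u & all (leq lo) u]) (subseqs w).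
Proof.
elim: w lo k => [|x w IHw] lo [|k] //=; rewrite count_cat count_map.
  by rewrite -(IHw lo 0) chains0 (@eq_count _ _ pred0) ?count_pred0.
rewrite addnC -IHw; congr (_ + _).
case: leqP => [le_lo_x|lt_x_lo]; last first.
  rewrite (@eq_count _ _ pred0) ?count_pred0 // => u /=.
  by rewrite leqNgt lt_x_lo /= !andbF.
rewrite mul1n IHw; apply: eq_count => u /=; rewrite le_lo_x eqSS.
rewrite path_sortedE; last exact: ltn_trans.
case: eqP => //= _; case: (sorted _ _) => /=; rewrite ?andbF // andbT.
apply/idP/andP => [lt_xu|[] //]; split=> //.
by apply: sub_all lt_xu => y /= lt_xy; apply: leq_trans (ltnW lt_xy).
Qed.

Lemma card_occurrences_increasing k n (pi : 'S_n) :
  #|occurrences (increasing k) pi| = chains 0 k (word pi).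
Proof.
rewrite card_occurrences chains_subseqs; apply: eq_count => u.
by rewrite matches_increasing (@eq_all _ (leq 0) predT) // all_predT andbT.
Qed.

(** In a word of distinct letters, the letters that follow [x] and exceed it must
    increase if 132 is avoided; conversely a descent among them completes an
    occurrence that starts at [x]. *)
Fixpoint av132 (w : seq nat) : bool :=
  if w is x :: t then sorted ltn [seq y <- t | x < y] && av132 t else true.

Lemma has_subseqs1 (P : pred nat) t :
  has (fun v => if v is [:: c] then P c else false) (subseqs t) = has P t.
Proof.
elim: t => //= c t IHt; rewrite has_cat IHt has_map; congr (_ || _).
apply/hasP/idP => [[[|? ?]] // | Pc].
by exists [::]; rewrite // mem_subseqs sub0seq.
Qed.

Lemma has_subseqs2 (x : nat) t : uniq t ->
  has (fun v => if v is [:: b; c] then x < c < b else false) (subseqs t) =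
  ~~ sorted ltn [seq y <- t | x < y].
Proof.
rewrite sorted_pairwise; last exact: ltn_trans.
elim: t => //= b t IHt /andP[nbt ut]; rewrite has_cat has_map IHt //.
case: ltnP => [lt_xb|le_bx] /=.
  rewrite negb_and; congr (_ || _); rewrite all_filter -has_predC.
  transitivity (has (fun c => x < c < b) t).
    by rewrite -has_subseqs1; apply: eq_has => -[|? [|? ?]].
  apply: eq_in_has => c ct /=.
  have : c != b by apply: contraNneq nbt => <-.
  by case: ltnP => //= _; rewrite -leqNgt ltn_neqAle => ->.
apply/orb_idl => /hasP[[|c [|? ?]]] //= _ /andP[lt_xc lt_cb].
by move: (ltn_trans lt_xc lt_cb); rewrite ltnNge le_bx.
Qed.

Lemma avoids_pat132 n (pi : 'S_n) : avoids pat132 pi = av132 (word pi).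
Proof.
have: uniq (word pi) by rewrite (perm_uniq (perm_word pi)) iota_uniq.
rewrite /avoids -cards_eq0 card_occurrences -leqn0 leqNgt -has_count.
rewrite (eq_has matches_pat132).
elim: (word pi) => //= x t IHt /andP[_ ut].
rewrite has_cat negb_or IHt // has_map; congr (_ && _).
by rewrite -[RHS]negbK -has_subseqs2 //; congr (~~ _).
Qed.

Lemma av132_homo (f : nat -> nat) w :
  {mono f : x y / x < y} -> av132 (map f w) = av132 w.
Proof.
move=> f_mono; elim: w => //= x w ->; rewrite filter_map sorted_map.
rewrite (eq_sorted (e' := ltn)) => [|a b]; last exact: f_mono.
by congr (sorted _ _ && _); apply: eq_filter => y /=; rewrite f_mono.
Qed.

(** * Decomposition around the maximum *)

(** In a permutation that avoids 132, what precedes the maximum lies above what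
    follows it; this is why [L] is the block that gets shifted. *)
Definition skew_sum (L R : seq nat) : seq nat :=
  map (addn (size R)) L ++ (size L + size R) :: R.

Lemma av132_cat n L R :
  all (fun y => y < n) L -> all (fun y => y < n) R ->
  {in L & R, forall x y, y < x} ->
  av132 (L ++ n :: R) = av132 L && av132 R.
Proof.
have filter_gt x R' : all (fun y => y < x) R' -> [seq y <- R' | x < y] = [::].
  move=> /allP ltR; rewrite (@eq_in_filter _ _ pred0) ?filter_pred0 // => y /ltR.
  by move=> lt_yx; rewrite ltnNge ltnW.
elim: L => [|x L IHL] /=; first by move=> _ ltR _; rewrite filter_gt.
move=> /andP[lt_xn ltL] ltR ltRL; rewrite IHL // => [|a b La Rb]; last first.
  by rewrite ltRL // inE La orbT.
rewrite andbA filter_cat /= lt_xn (filter_gt x R); last first.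
  by apply/allP => y Ry; rewrite ltRL ?mem_head.
congr (_ && _ && _); rewrite cats1 !sorted_pairwise ?pairwise_rcons; try exact: ltn_trans.
by rewrite all_filter (sub_all _ ltL) // => y /= ->; rewrite implybT.
Qed.

(** A letter of [L] followed by [n] and then by a larger letter of [R] would be an
    occurrence of 132. *)
Lemma av132_cat_lt n L R :
  uniq (L ++ R) -> all (fun y => y < n) L -> all (fun y => y < n) R ->
  av132 (L ++ n :: R) -> {in L & R, forall x y, y < x}.
Proof.
elim: L => //= x L IHL /andP[nx uLR] /andP[lt_xn ltL] ltR /andP[sx av] a b.
rewrite inE => /orP[/eqP->|La] Rb; last exact: IHL.
have ne_bx : b != x by apply: contraNneq nx => <-; rewrite mem_cat Rb orbT.
rewrite ltn_neqAle ne_bx leqNgt; apply/negP => lt_xb.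
move: sx; rewrite filter_cat /= lt_xn sorted_pairwise; last exact: ltn_trans.
rewrite pairwise_cat /= => /and3P[_ _ /andP[/allP/(_ b)]].
by rewrite mem_filter lt_xb Rb /= ltnNge ltnW ?(allP ltR) // => /(_ isT).
Qed.

(** Sorting [R] and then [L] sorts the whole word, so the two sorted blocks are
    the initial and the final segment of the interval. *)
Lemma perm_iota_cat L R n :
  {in L & R, forall x y, y < x} -> perm_eq (L ++ R) (iota 0 n) ->
  perm_eq R (iota 0 (size R)) /\ perm_eq L (iota (size R) (size L)).
Proof.
move=> ltRL pLR; have szn : n = size R + size L.
  by have := perm_size pLR; rewrite size_iota size_cat addnC => ->.
have sorted_sort s : sorted leq (sort leq s) by apply: (sort_sorted leq_total).
have pS : perm_eq (sort leq R ++ sort leq L) (iota 0 n).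
  by apply: perm_trans pLR; rewrite perm_catC perm_cat ?perm_sort.
have : sort leq R ++ sort leq L = iota 0 n.
  apply: (sorted_eq leq_trans anti_leq) => //; last exact: iota_sorted.
  rewrite sorted_pairwise; last exact: leq_trans.
  rewrite pairwise_cat -!sorted_pairwise ?sorted_sort ?andbT; try exact: leq_trans.
  by apply/allrelP => x y; rewrite !mem_sort => Rx Ly; rewrite ltnW ?ltRL.
rewrite szn iotaD add0n => /eqP; rewrite eqseq_cat ?size_sort ?size_iota //.
by case/andP => /eqP eR /eqP eL; split; [rewrite -eR | rewrite -eL];
  rewrite perm_sym perm_sort.
Qed.

Definition Av132 n : seq (seq nat) := [seq w <- permutations (iota 0 n) | av132 w].

Lemma mem_Av132 n w : (w \in Av132 n) = av132 w && perm_eq w (iota 0 n).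
Proof. by rewrite mem_filter mem_permutations. Qed.

Lemma size_Av132 n w : w \in Av132 n -> size w = n.
Proof. by rewrite mem_Av132 => /andP[_ /perm_size->]; rewrite size_iota. Qed.

Lemma Av132_lt n w : w \in Av132 n -> all (fun y => y < n) w.
Proof.
rewrite mem_Av132 => /andP[_ /perm_mem eqw].
by apply/allP => y; rewrite eqw mem_iota.
Qed.

Lemma skew_lt L R n : all (fun y => y < n) R -> size R = n ->
  {in map (addn (size R)) L & R, forall x y, y < x}.
Proof.
by move=> /allP ltR szR _ y /mapP[x _ ->] /ltR; lia.
Qed.

Lemma Av132_skew n w :
  (w \in Av132 n.+1) <->
  exists j L R, [/\ j < n.+1, L \in Av132 j, R \in Av132 (n - j) & w = skew_sum L R].
Proof.
split=> [|[j [L [R [lt_jn AvL AvR ->]]]]].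
  rewrite mem_Av132 => /andP[avw pw].
  have nw : n \in w by rewrite (perm_mem pw) mem_iota ltnSn.
  case/splitPr: nw avw pw => L R av p.
  have pLR : perm_eq (L ++ R) (iota 0 n).
    rewrite -(perm_cons n) -cat1s; apply: perm_trans (_ : perm_eq (L ++ n :: R) _).
      by rewrite perm_catCA.
    by apply: perm_trans p _; rewrite -addn1 iotaD cats1 add0n perm_rcons.
  have uLR : uniq (L ++ R) by rewrite (perm_uniq pLR) iota_uniq.
  have : all (fun y => y < n) (L ++ R).
    by apply/allP => y; rewrite (perm_mem pLR) mem_iota.
  rewrite all_cat => /andP[ltL ltR].
  have ltRL := av132_cat_lt uLR ltL ltR av.
  have [pR pL] := perm_iota_cat ltRL pLR.
  have szn : n = size L + size R.
    by have := perm_size pLR; rewrite size_iota size_cat => ->.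
  pose L' := map (subn^~ (size R)) L.
  have defL : L = map (addn (size R)) L'.
    rewrite -map_comp map_id_in // => x; rewrite (perm_mem pL) mem_iota => /andP[lex _].
    exact: subnKC.
  exists (size L), L', R; split.
  - by rewrite szn; lia.
  - rewrite mem_Av132; apply/andP; split; last first.
      apply: (perm_map_inj (@addnI (size R))); rewrite -defL.
      by rewrite -iotaDl addn0.
    move: av; rewrite av132_cat // => /andP[+ _]; rewrite {1}defL.
    by rewrite av132_homo // => x y; rewrite ltn_add2l.
  - by rewrite mem_Av132 szn addKn pR; move: av; rewrite av132_cat // => /andP[_ ->].
  - by rewrite /skew_sum -defL size_map -szn.
have [szL szR] := (size_Av132 AvL, size_Av132 AvR).
have ltRL := skew_lt (L := L) (Av132_lt AvR) szR.
have ltn_ : size L + size R = n by lia.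
move: (AvL) (AvR); rewrite !mem_Av132 => /andP[avL pL] /andP[avR pR].
rewrite /skew_sum ltn_ av132_cat // ?av132_homo ?avL ?avR /=.
- rewrite -cat1s perm_catCA cat1s -[_ :: iota 1 n]/(iota 0 n.+1) -addn1 iotaD add0n cats1.
  rewrite perm_sym perm_rcons perm_cons perm_sym -ltn_ addnC iotaD perm_catC.
  rewrite perm_cat ?szR // add0n szL -[n - j]addn0 iotaDl.
  by rewrite addn0; apply: perm_map.
- by move=> x y; rewrite ltn_add2l.
- rewrite all_map; apply: sub_all (Av132_lt AvL) => y /= lt_yj.
  by rewrite -ltn_ szL addnC ltn_add2r.
by apply: sub_all (Av132_lt AvR) => y /= /leq_trans; apply; apply: leq_subr.
Qed.

(** The position of the largest letter recovers j, which fixes where the two blocks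
    begin and end. *)
Lemma skew_inj j j' n L L' R R' :
  L \in Av132 j -> R \in Av132 (n - j) -> L' \in Av132 j' -> R' \in Av132 (n - j') ->
  j <= n -> j' <= n -> skew_sum L R = skew_sum L' R' -> [/\ j = j', L = L' & R = R'].
Proof.
move=> AvL AvR AvL' AvR' lejn lej'n eqw.
have idx i A B : A \in Av132 i -> B \in Av132 (n - i) -> i <= n -> index n (skew_sum A B) = i.
  move=> AvA AvB lein; have [szA szB] := (size_Av132 AvA, size_Av132 AvB).
  rewrite /skew_sum index_cat size_map szA szB subnKC //= eqxx addn0 ifF //.
  apply/negbTE/mapP => -[x Ax def_n]; have := allP (Av132_lt AvA) x Ax; lia.
have eqj : j = j' by rewrite -(idx _ _ _ AvL AvR lejn) eqw (idx _ _ _ AvL' AvR').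
move: eqw; rewrite /skew_sum => /eqP; rewrite eqseq_cat; last first.
  by rewrite !size_map (size_Av132 AvL) (size_Av132 AvL').
rewrite eqseq_cons => /and3P[/eqP eqL _ /eqP eqR]; split=> //.
by move: eqL; rewrite eqR => /inj_map; apply; apply: addnI.
Qed.

Lemma inversions_cat n L R :
  all (fun y => y < n) L -> all (fun y => y < n) R ->
  {in L & R, forall x y, y < x} ->
  inversions (L ++ n :: R) =
    inversions L + inversions R + (size L).+1 * size R.
Proof.
have count_all x s : all (fun y => y < x) s -> count (fun y => y < x) s = size s.
  by rewrite all_count => /eqP.
elim: L => [|x L IHL] /=; first by move=> _ /count_all-> _; rewrite mul1n addnC.
move=> /andP[lt_xn ltL] ltR ltRL; rewrite IHL // => [|a b La Rb]; last first.
  by rewrite ltRL // inE La orbT.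
rewrite count_cat /= ltnNge ltnW //= (count_all x R) ?mulSn; first by lia.
by apply/allP => y Ry; rewrite ltRL ?mem_head.
Qed.

Lemma chains_lt lo k w : all (fun y => y < lo) w -> chains lo k.+1 w = 0.
Proof. by elim: w => //= x w IHw /andP[lt_x /IHw->]; rewrite leqNgt lt_x. Qed.

Lemma chains_shift d lo k w :
  chains lo k (map (addn d) w) = chains (lo - d) k w.
Proof.
elim: w lo k => [|x w IHw] lo [|k] //=; rewrite IHw leq_subLR; congr (_ + _ * _).
by rewrite IHw -addnS addKn.
Qed.

(** An increasing subsequence cannot use letters of both [L] and [R], nor [n]
    together with a letter of [R]: it lies in [L], or lies in [R], or consists of
    one of [L] followed by [n]. *)
Lemma chains_cat lo k n L R : lo <= n ->
  all (fun y => y < n) L -> all (fun y => y < n) R ->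
  {in L & R, forall x y, y < x} ->
  chains lo k.+1 (L ++ n :: R) =
    chains lo k.+1 L + chains lo k L + chains lo k.+1 R.
Proof.
elim: L lo k => [|x L IHL] lo k /= le_lo_n.
  move=> _ ltR _; rewrite le_lo_n mul1n add0n addnC; congr (_ + _).
  case: k => [|k]; first by rewrite chains0.
  by rewrite chains_lt //; apply: sub_all ltR => y /leqW.
move=> /andP[lt_xn ltL] ltR ltRL; have ltRL' : {in L & R, forall x y, y < x}.
  by move=> a b La Rb; rewrite ltRL // inE La orbT.
rewrite IHL //; case: k => [|k]; first by rewrite !chains0 /=; lia.
rewrite IHL // (@chains_lt x.+1 k R); first by case: (lo <= x); rewrite /= ?mul1n ?mul0n; lia.
by apply/allP => y Ry; rewrite ltnW // ltnS ltRL ?mem_head.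
Qed.

Lemma chains_gt0 lo k w : 0 < chains lo k.+1 w -> 0 < chains lo k w.
Proof.
elim: w lo k => [|x w IHw] lo [|k] //=; rewrite ?chains0 // !addn_gt0 !muln_gt0.
case/orP => [/IHw-> // | /andP[-> /IHw->]].
by rewrite orbT.
Qed.

Lemma chains_mono lo lo' k w : lo <= lo' -> chains lo' k w <= chains lo k w.
Proof.
move=> le_lo; elim: w k => [|x w IHw] [|k] //=; apply: leq_add; first exact: IHw.
by case: (leqP lo' x) => // /(leq_trans le_lo)->.
Qed.

(** Dropping the last letter, or the first one, of an increasing sequence of
    length k+2 leaves two different ones of length k+1. *)
Lemma chains_gt1 lo k w : 0 < chains lo k.+2 w -> 1 < chains lo k.+1 w.
Proof.
elim: w lo k => [|x w IHw] lo k //=; rewrite addn_gt0 muln_gt0 lt0b.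
case/orP => [/IHw/leq_trans-> //|/andP[le_lo_x gt0]]; first exact: leq_addr.
rewrite le_lo_x mul1n -[1.+1]/(1 + 1); apply: leq_add; last exact: chains_gt0.
by apply: leq_trans gt0 _; apply: chains_mono; apply: leq_trans le_lo_x _.
Qed.

Lemma chains_size w : chains 0 1 w = size w.
Proof. by elim: w => //= x w ->; rewrite chains0 addn1. Qed.

Lemma Av132_skew_blocks n j L R : j < n.+1 -> L \in Av132 j -> R \in Av132 (n - j) ->
  [/\ all (fun y => y < n) (map (addn (size R)) L), all (fun y => y < n) R,
      {in map (addn (size R)) L & R, forall x y, y < x} &
      skew_sum L R = map (addn (size R)) L ++ n :: R].
Proof.
move=> ltj AvL AvR; have [szL szR] := (size_Av132 AvL, size_Av132 AvR).
split; last by rewrite /skew_sum szL szR subnKC.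
- rewrite all_map; apply: sub_all (Av132_lt AvL) => y /= lt_yj.
  by rewrite szR -ltn_subRL subKn.
- by apply: sub_all (Av132_lt AvR) => y /= /leq_trans; apply; apply: leq_subr.
- exact: skew_lt (Av132_lt AvR) szR.
Qed.

Lemma inversions_skew n j L R :
  j < n.+1 -> L \in Av132 j -> R \in Av132 (n - j) ->
  inversions (skew_sum L R) = inversions L + inversions R + j.+1 * (n - j).
Proof.
move=> ltj AvL AvR; have [ltL ltR ltRL ->] := Av132_skew_blocks ltj AvL AvR.
rewrite inversions_cat // size_map (size_Av132 AvL) (size_Av132 AvR).
by rewrite inversions_homo // => x y; rewrite ltn_add2l.
Qed.

Lemma chains_skew n j k L R :
  j < n.+1 -> L \in Av132 j -> R \in Av132 (n - j) ->
  chains 0 k.+1 (skew_sum L R) = chains 0 k.+1 L + chains 0 k L + chains 0 k.+1 R.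
Proof.
move=> ltj AvL AvR; have [ltL ltR ltRL ->] := Av132_skew_blocks ltj AvL AvR.
by rewrite chains_cat // !chains_shift.
Qed.

(** * Signed and unsigned generating functions *)

Local Open Scope ring_scope.

Lemma sum_Av132 (V : nmodType) n (F : seq nat -> V) :
  \sum_(w <- Av132 n.+1) F w =
  \sum_(j < n.+1) \sum_(L <- Av132 j) \sum_(R <- Av132 (n - j)) F (skew_sum L R).
Proof.
pose B := [seq (j, LR) | j <- iota 0 n.+1,
  LR <- [seq (L, R) | L <- Av132 j, R <- Av132 (n - j)]].
have uAv i : uniq (Av132 i) by rewrite filter_uniq ?permutations_uniq.
have memB j L R : (j, (L, R)) \in B ->
    [/\ (j < n.+1)%N, L \in Av132 j & R \in Av132 (n - j)].
  case/allpairsPdep => i [LR [+ /allpairsP[[L' R'] /= [AvL' AvR' ->]] [-> -> ->]]].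
  by rewrite mem_iota; split.
have uB : uniq B.
  apply: allpairs_uniq_dep => [|j _|]; first exact: iota_uniq.
    by apply: allpairs_uniq => // -[? ?] [? ?] _ _ [-> ->].
  by move=> [? ?] [? ?] _ _ [-> ->].
have pB : perm_eq (Av132 n.+1) [seq skew_sum t.2.1 t.2.2 | t <- B].
  apply: uniq_perm => //.
    rewrite map_inj_in_uniq // => -[j [L R]] [j' [L' R']].
    move=> /memB[ltj AvL AvR] /memB[ltj' AvL' AvR'] /= eqw.
    by have [-> -> ->] := skew_inj AvL AvR AvL' AvR' ltj ltj' eqw.
  move=> w; apply/idP/mapP => [/Av132_skew[j [L [R [ltj AvL AvR ->]]]]|].
    exists (j, (L, R)) => //; apply/allpairsPdep; exists j, (L, R).
    by split; rewrite ?mem_iota //; apply/allpairsP; exists (L, R).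
  by case=> -[j [L R]] /memB[ltj AvL AvR] ->; apply/Av132_skew; exists j, L, R.
rewrite (perm_big _ pB) big_map big_allpairs_dep -[iota 0 n.+1]/(index_iota 0 n.+1) big_mkord.
by apply: eq_bigr => j _; rewrite big_allpairs.
Qed.

(** The boolean [b] selects between counting with signs ([true]) and without
    ([false]), so that the recurrences are proved once for both. *)
Definition sgn (b : bool) (w : seq nat) : rat := (-1) ^+ (b && odd (inversions w)).

Definition chain_series (b : bool) (k r : nat) : fps rat :=
  Fps (fun n => \sum_(w <- Av132 n) sgn b w * (chains 0 k w == r)%:R).

(** The Cauchy product twisted by the sign that comes from the inversions between
    the block above, the maximum, and the block below. *)
Definition skew_mul (b : bool) (f g : fps rat) : fps rat :=
  Fps (fun n => \sum_(j < n.+1)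
    (-1) ^+ (b && odd (j.+1 * (n - j))) * (f j * g (n - j)%N)).

Lemma sgn_skew b n j L R :
  (j < n.+1)%N -> L \in Av132 j -> R \in Av132 (n - j) ->
  sgn b (skew_sum L R) = (-1) ^+ (b && odd (j.+1 * (n - j))) * (sgn b L * sgn b R).
Proof.
move=> ltj AvL AvR; rewrite /sgn (inversions_skew ltj AvL AvR) !oddD.
by case: b; rewrite ?mulr1 //= !signr_addb [LHS]mulrC.
Qed.

Lemma sum_skew b n j (p q : seq nat -> bool) : (j < n.+1)%N ->
  \sum_(L <- Av132 j) \sum_(R <- Av132 (n - j)) sgn b (skew_sum L R) * (p L && q R)%:R =
  (-1) ^+ (b && odd (j.+1 * (n - j))) *
    ((\sum_(L <- Av132 j) sgn b L * (p L)%:R) *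
     (\sum_(R <- Av132 (n - j)) sgn b R * (q R)%:R)).
Proof.
move=> ltj; rewrite big_distrl big_distrr /= big_seq [RHS]big_seq.
apply: eq_bigr => L AvL; rewrite big_distrr big_distrr /= big_seq [RHS]big_seq.
apply: eq_bigr => R AvR; rewrite (sgn_skew b ltj AvL AvR) -(mulnb (p L)) natrM; ring.
Qed.

Lemma fps_addE (f g : fps rat) n : (f + g) n = f n + g n.
Proof. by []. Qed.

Lemma fps_XM (f : fps rat) n : (fps_X rat * f) n.+1 = f n.
Proof.
rewrite [LHS]big_ord_recl /= mul0r add0r big_ord_recl /= mul1r.
rewrite big1 => [|i _]; last by rewrite mul0r.
by rewrite addr0 /bump /= subn1.
Qed.

Lemma fps_XM0 (f : fps rat) : (fps_X rat * f) 0%N = 0.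
Proof. by rewrite [LHS]big_ord_recl big_ord0 /= mul0r addr0. Qed.

Lemma chain_series_avoid0 b : chain_series b 0 0 = 0.
Proof.
by apply: fpsP => n /=; rewrite big1 // => w _; rewrite chains0 mulr0.
Qed.

Lemma chain_series0 b k r : chain_series b k r 0%N = (chains 0 k [::] == r)%:R.
Proof.
by rewrite /= /Av132 /= big_cons big_nil addr0 /sgn /= andbF mul1r.
Qed.

(** The skew sum of [L] and [R] avoids [k+1] exactly when [L] avoids [k] and [R]
    avoids [k+1]; for [k = 0] the series [chain_series b 0 0] vanishes, since the
    empty pattern always occurs, and the recurrence still holds. *)
Lemma chain_series_avoid b k :
  chain_series b k.+1 0 =
  1 + fps_X rat * skew_mul b (chain_series b k 0) (chain_series b k.+1 0).
Proof.
apply: fpsP => -[|n].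
  by rewrite chain_series0 fps_addE fps_XM0 addr0.
rewrite fps_addE fps_XM add0r.
rewrite [LHS]sum_Av132; apply: eq_bigr => j _; rewrite -sum_skew //.
rewrite big_seq [RHS]big_seq; apply: eq_bigr => L AvL.
rewrite big_seq [RHS]big_seq; apply: eq_bigr => R AvR.
rewrite (chains_skew k (ltn_ord j) AvL AvR); congr (_ * _%:R).
(* A (k+1)-chain of [L] would contain a k-chain of [L]. *)
have := @chains_gt0 0 k L; rewrite !addn_eq0 -andbA.
by case: (chains 0 k.+1 L) => // ?; case: (chains 0 k L) => // /(_ isT).
Qed.

Lemma chain_series_once1 b : chain_series b 1 1 = fps_X rat.
Proof.
apply: fpsP => n /=; rewrite big_seq (eq_bigr (fun w => sgn b w * (n == 1%N)%:R)).
  rewrite -big_seq; case: eqP => [->|_]; last by rewrite big1 // => w; rewrite mulr0.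
  by rewrite /Av132 /= big_cons big_nil /sgn /= andbF mulr1 addr0.
by move=> w /size_Av132 szw; rewrite chains_size szw.
Qed.

Lemma chain_series_once b k :
  chain_series b k.+2 1 =
  fps_X rat * (skew_mul b (chain_series b k.+1 1) (chain_series b k.+2 0)
             + skew_mul b (chain_series b k.+1 0) (chain_series b k.+2 1)).
Proof.
apply: fpsP => -[|n]; first by rewrite chain_series0 fps_XM0.
rewrite fps_XM fps_addE -big_split.
rewrite [LHS]sum_Av132; apply: eq_bigr => j _; rewrite /= -!sum_skew // -big_split.
rewrite big_seq [RHS]big_seq; apply: eq_bigr => L AvL.
rewrite -big_split big_seq [RHS]big_seq; apply: eq_bigr => R AvR.
rewrite (chains_skew k.+1 (ltn_ord j) AvL AvR) /= -mulrDr -natrD; congr (_ * _%:R).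
(* If [L] has exactly one (k+1)-chain, it has no (k+2)-chain. *)
have := @chains_gt1 0 k L.
by case: (chains 0 k.+2 L) (chains 0 k.+1 L) (chains 0 k.+2 R) => [|?] [|[|?]] [|[|?]]; lia.
Qed.

(** * Even and odd parts of the signed recurrences *)

Definition even_part (f : fps rat) : fps rat := Fps (fun n => if odd n then 0 else f n).
Definition odd_part (f : fps rat) : fps rat := Fps (fun n => if odd n then f n else 0).

Lemma even_partE f n : even_part f n = if odd n then 0 else f n.
Proof. by []. Qed.

Lemma odd_partE f n : odd_part f n = if odd n then f n else 0.
Proof. by []. Qed.

Lemma even_odd_part f : even_part f + odd_part f = f.
Proof. by apply: fpsP => n /=; case: ifP => _; rewrite ?add0r ?addr0. Qed.

Lemma even_partD f g : even_part (f + g) = even_part f + even_part g.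
Proof. by apply: fpsP => n /=; case: ifP; rewrite ?addr0. Qed.

Lemma odd_partD f g : odd_part (f + g) = odd_part f + odd_part g.
Proof. by apply: fpsP => n /=; case: ifP; rewrite ?addr0. Qed.

Lemma even_part1 : even_part 1 = 1.
Proof. by apply: fpsP => -[|n] //=; case: ifP. Qed.

Lemma odd_part1 : odd_part 1 = 0.
Proof. by apply: fpsP => -[|n] //=; case: ifP. Qed.

Lemma even_partX : even_part (fps_X rat) = 0.
Proof. by apply: fpsP => -[|[|n]] //=; case: ifP. Qed.

Lemma odd_partX : odd_part (fps_X rat) = fps_X rat.
Proof. by apply: fpsP => -[|[|n]] //=; case: ifP. Qed.

Lemma skew_mul_false f g : skew_mul false f g = f * g.
Proof. by apply: fpsP => n; apply: eq_bigr => j _; rewrite mul1r. Qed.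

(** The twist is -1 exactly when the left index is even and the right index is
    odd, so it becomes a minus sign on one of the four products of parts.  The
    factor x exchanges the parities. *)
Lemma even_part_skew_mul f g :
  even_part (fps_X rat * skew_mul true f g) =
  fps_X rat * (odd_part f * even_part g - even_part f * odd_part g).
Proof.
apply: fpsP => -[|n]; first by rewrite [RHS]fps_XM0; apply: fps_XM0.
rewrite even_partE oddS !fps_XM [RHS]/= -sumrB; case: (boolP (odd n)) => /= on; last first.
  rewrite big1 // => j _; rewrite oddB ?leq_ord // (negPf on) /=.
  by case: (odd j); rewrite ?(mul0r, mulr0) subr0.
apply: eq_bigr => j _; rewrite oddM oddB ?leq_ord // on /=.
by case: (odd j); rewrite /= ?(mul0r, mulr0, mul1r, mulN1r, subr0, sub0r).
Qed.

Lemma odd_part_skew_mul f g :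
  odd_part (fps_X rat * skew_mul true f g) =
  fps_X rat * (odd_part f * odd_part g + even_part f * even_part g).
Proof.
apply: fpsP => -[|n]; first by rewrite [RHS]fps_XM0.
rewrite odd_partE oddS !fps_XM [RHS]/= -big_split; case: (boolP (odd n)) => /= on.
  rewrite big1 // => j _; rewrite oddB ?leq_ord // on /=.
  by case: (odd j); rewrite ?(mul0r, mulr0) addr0.
apply: eq_bigr => j _; rewrite oddM oddB ?leq_ord // (negPf on) /=.
by case: (odd j); rewrite /= ?(mul0r, mulr0, mul1r, mulN1r, addr0, add0r).
Qed.

(** * Substitution in the field of Laurent series *)

Lemma sum_even_index (V : nmodType) (H : nat -> V) m :
  (forall i, odd i -> H i = 0) ->
  \sum_(i < m.*2.+1) H i = \sum_(i < m.+1) H i.*2.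
Proof.
move=> H0; elim: m => [|m IHm]; first by rewrite !big_ord_recr !big_ord0.
rewrite doubleS big_ord_recr [RHS]big_ord_recr -IHm big_ord_recr /=.
by rewrite [H _.+1]H0 ?addr0 //= odd_double.
Qed.

(** On the right-hand side only pairs of even indices contribute, and there are
    none when the total index is odd. *)
Lemma fps_sqM (f g : fps rat) : fps_sq (f * g) = fps_sq f * fps_sq g.
Proof.
apply: fpsP => n.
have H0 i : odd i || odd (n - i)%N -> fps_sq f i * fps_sq g (n - i)%N = 0.
  by rewrite /=; do 2!case: ifP => //; rewrite ?mul0r ?mulr0.
rewrite [LHS]/=; case: ifP => [on | /negbT en].
  symmetry; apply: big1 => i _; apply: H0; rewrite oddB ?leq_ord // on.
  by case: (odd i).
have [m def_n] : exists m, n = m.*2 by exists n./2; rewrite even_halfK.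
subst n; rewrite doubleK.
rewrite [RHS](sum_even_index (H := fun i => fps_sq f i * fps_sq g (m.*2 - i)%N)).
  by apply: eq_bigr => i _; rewrite /= -doubleB !odd_double !doubleK.
by move=> i oi; apply: H0; rewrite oi.
Qed.

Lemma fps_sqX : fps_sq (fps_X rat) = fps_X rat ^+ 2.
Proof.
apply: fpsP => -[|n]; first by rewrite expr2 fps_XM0.
rewrite expr2 fps_XM /=; case: n => [|[|[|n]]] //=.
by case: ifP.
Qed.

Lemma at_xD f g : at_x (f + g) = at_x f + at_x g.
Proof.
rewrite /at_x -tofracD; congr tofrac; apply: fpsP => n /=.
by case: ifP; rewrite ?addr0.
Qed.

Lemma at_xN f : at_x (- f) = - at_x f.
Proof.
rewrite /at_x -tofracN; congr tofrac; apply: fpsP => n /=.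
by case: ifP; rewrite ?oppr0.
Qed.

Lemma at_xM f g : at_x (f * g) = at_x f * at_x g.
Proof. by rewrite /at_x fps_sqM tofracM. Qed.

Lemma at_x1 : at_x 1 = 1.
Proof.
rewrite /at_x -[RHS]tofrac1; congr tofrac; apply: fpsP => -[|[|n]] //=.
by case: ifP.
Qed.

Lemma at_x0 : at_x 0 = 0.
Proof. by rewrite -(subrr 1) at_xD at_xN subrr. Qed.

Lemma at_xX : at_x (fps_X rat) = varx.
Proof. by rewrite /at_x fps_sqX tofracXn. Qed.

Lemma fps_sqD f g : fps_sq (f + g) = fps_sq f + fps_sq g :> fps rat.
Proof. by apply: fpsP => n /=; case: ifP; rewrite ?addr0. Qed.

Lemma fps_sq1 : fps_sq 1 = 1 :> fps rat.
Proof. by apply: fpsP => -[|[|n]] //=; case: ifP. Qed.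

Lemma fps_sq0 : fps_sq 0 = 0 :> fps rat.
Proof. by apply: fpsP => n /=; case: ifP. Qed.

Lemma sqrtx_neq0 : sqrtx != 0.
Proof.
rewrite tofrac_eq0; apply/eqP => /(congr1 (fun f : fps rat => f 1%N)) /eqP.
by rewrite /= oner_eq0.
Qed.

Lemma laurent2_neq0 : (2 : laurent) != 0.
Proof.
rewrite -(rmorph_nat (@tofrac (fps rat)) 2) tofrac_eq0.
apply/eqP => /(congr1 (fun f : fps rat => f 0%N)) /eqP.
by rewrite mulr2n fps_addE.
Qed.

(** * Solving the recurrences in a field *)

Section FieldAlgebra.
Variable F : fieldType.
Implicit Types t x y : F.

Lemma Uval_rec k t : Uval k.+2 t = 2 * t * Uval k.+1 t - Uval k t.
Proof. by rewrite /Uval /= !hornerE. Qed.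

Variables (t : F) (r : nat -> F).
Hypotheses (nz2 : 2 != 0 :> F) (nzt : t != 0).
Hypotheses (r0 : r 0%N = 0) (rS : forall k, r k.+1 = 1 + t ^+ 2 * (r k * r k.+1)).

Let u k := Uval k (1 / (2 * t)).

(** The Chebyshev recurrence reads u_(k+2) = u_(k+1) (1 - t^2 r_(k+1)) / t once
    u_k / u_(k+1) is known to be t r_(k+1), and r_(k+2) inverts the middle factor;
    this gives the next ratio.  Nor can u_(k+1) vanish: division by 0 being 0, the
    formula for r_(k+1) would then give 0, against the recurrence of r. *)
Lemma Uval_ratio k : u k != 0 /\ r k.+1 = u k / (t * u k.+1).
Proof.
elim: k => [|k [nzu rk]].
  have u0 : u 0%N = 1 by rewrite /u /Uval /= hornerE.
  have u1 : u 1%N = t^-1 by rewrite /u /Uval /= !hornerE /=; field; rewrite nz2 nzt.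
  by rewrite rS r0 u0 u1 oner_eq0; split=> //; rewrite mul0r mulr0 addr0 divff // divr1.
have rel : r k.+2 * (1 - t ^+ 2 * r k.+1) = 1.
  rewrite -[RHS](addrK (t ^+ 2 * (r k.+1 * r k.+2))) -rS; ring.
have nzd : 1 - t ^+ 2 * r k.+1 != 0.
  by apply: contraTneq isT => d0; move: rel; rewrite d0 mulr0 => /esym/eqP; rewrite oner_eq0.
have nzr : r k.+1 != 0.
  apply/eqP => rk0; move: (rS k); rewrite rk0 !mulr0 addr0 => /esym/eqP.
  by rewrite oner_eq0.
have nzu' : u k.+1 != 0 by apply: contraNneq nzr => uk0; rewrite rk uk0 mulr0 invr0 mulr0.
split=> //.
have uE : u k.+2 = u k.+1 * (1 - t ^+ 2 * r k.+1) / t.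
  by rewrite /u Uval_rec -/(u _) -/(u _) rk; field; rewrite nz2 nzt nzu'.
rewrite uE -[LHS]mulr1 -{1}(divff nzd) mulrA rel; field.
by rewrite nzt nzd nzu'.
Qed.

End FieldAlgebra.

(** The sequences [e], [o] stand for the even and odd parts of the signed series of
    the permutations that avoid the increasing pattern, [p], [q] for those of the
    permutations that contain it once, and [r k] for R_k(x^2). *)
Section Signed.
Variable F : fieldType.
Implicit Types a b c d e o p q r u v x y : F.

(** The system says (1 - i y) (u + i v) = a + i b. *)
Lemma rotation_system y a b u v : 1 + y ^+ 2 != 0 ->
  u = a - y * v -> v = b + y * u ->
  u = (a - y * b) / (1 + y ^+ 2) /\ v = (b + y * a) / (1 + y ^+ 2).
Proof.
move=> nzD def_u def_v.
have hu : u * (1 + y ^+ 2) = a - y * b.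
  by rewrite mulrDr mulr1 {1}def_u {1}def_v; ring.
have hv : v * (1 + y ^+ 2) = b + y * a.
  by rewrite mulrDr mulr1 {1}def_v {1}def_u; ring.
by rewrite -hu -hv !mulfK.
Qed.

Variables (x : F) (r e o p q : nat -> F).
Hypotheses (r0 : r 0%N = 0) (rS : forall k, r k.+1 = 1 + x ^+ 2 * (r k * r k.+1)).
Hypotheses (e0 : e 0%N = 0) (o0 : o 0%N = 0).
Hypothesis eS : forall k, e k.+1 = 1 + x * (o k * e k.+1 - e k * o k.+1).
Hypothesis oS : forall k, o k.+1 = x * (o k * o k.+1 + e k * e k.+1).
Hypotheses (p1 : p 1%N = 0) (q1 : q 1%N = x).
Hypothesis pS : forall k, p k.+2 =
  x * (q k.+1 * e k.+2 - p k.+1 * o k.+2 + (o k.+1 * p k.+2 - e k.+1 * q k.+2)).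
Hypothesis qS : forall k, q k.+2 =
  x * (q k.+1 * o k.+2 + p k.+1 * e k.+2 + (o k.+1 * q k.+2 + e k.+1 * p k.+2)).

Lemma scaled_solve (d d' c u : F) : d * d' = 1 -> u * d = c -> u = d' * c.
Proof. by move=> dd <-; rewrite mulrCA [d' * d]mulrC dd mulr1. Qed.

Lemma r_inv k : (1 - x ^+ 2 * r k) * r k.+1 = 1.
Proof.
rewrite -[RHS](addrK (x ^+ 2 * (r k * r k.+1))) -rS; ring.
Qed.

(** The squared modulus of 1 + i x R_(k+1)(x^2). *)
Definition rden k := 1 + (x * r k.+1) ^+ 2.

(** The denominator cannot vanish, because its product with [e m.*2.+2] is
    [r m.+1], which is invertible. *)
Lemma avoid_step_even m : e m.*2.+1 = 1 -> o m.*2.+1 = x * r m ->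
  [/\ rden m != 0, e m.*2.+2 = r m.+1 / rden m & o m.*2.+2 = x * r m.+1 ^+ 2 / rden m].
Proof.
move=> em om; set R := r m.+1; have Rinv := r_inv m; rewrite -/R in Rinv.
have nzR : R != 0.
  by apply: contraTneq isT => R0; move: Rinv; rewrite R0 mulr0 => /esym/eqP; rewrite oner_eq0.
have oE : o m.*2.+2 = R * (x * e m.*2.+2).
  apply: scaled_solve Rinv _; rewrite {1}mulrBr mulr1 {1}oS em om; ring.
have eE : e m.*2.+2 = R * (1 - x * o m.*2.+2).
  apply: scaled_solve Rinv _; rewrite {1}mulrBr mulr1 {1}eS em om; ring.
have eD : e m.*2.+2 * rden m = R.
  by rewrite /rden -/R mulrDr mulr1 {1}eE oE; ring.
have nzD : rden m != 0 by apply: contraNneq nzR => D0; rewrite -eD D0 mulr0.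
have eV : e m.*2.+2 = R / rden m by rewrite -eD mulfK.
by split=> //; rewrite oE eV; field.
Qed.

Lemma avoid_step_odd m : rden m != 0 ->
  e m.*2.+2 = r m.+1 / rden m -> o m.*2.+2 = x * r m.+1 ^+ 2 / rden m ->
  e m.*2.+3 = 1 /\ o m.*2.+3 = x * r m.+1.
Proof.
move=> nzD em om; have dd : (1 - x * o m.*2.+2) * rden m = 1.
  by rewrite om /rden; field; rewrite -/(rden m).
have eE : e m.*2.+3 = rden m - (x * r m.+1) * o m.*2.+3.
  rewrite [LHS](scaled_solve (c := 1 - x * e m.*2.+2 * o m.*2.+3) dd).
    by rewrite em; field.
  by rewrite mulrBr mulr1 {1}eS; ring.
have oE : o m.*2.+3 = 0 + (x * r m.+1) * e m.*2.+3.
  rewrite [LHS](scaled_solve (c := x * e m.*2.+2 * e m.*2.+3) dd).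
    by rewrite em; field.
  by rewrite mulrBr mulr1 {1}oS; ring.
have [-> ->] := rotation_system nzD eE oE.
by rewrite -/(rden m); split; field.
Qed.

Lemma avoid_odd m : e m.*2.+1 = 1 /\ o m.*2.+1 = x * r m.
Proof.
elim: m => [|m [em om]].
  by rewrite eS oS e0 o0 r0 !mul0r subr0 addr0 !mulr0 addr0.
have [nzD em' om'] := avoid_step_even em om.
exact: avoid_step_odd nzD em' om'.
Qed.

Lemma avoid_even m :
  [/\ rden m != 0, e m.*2.+2 = r m.+1 / rden m & o m.*2.+2 = x * r m.+1 ^+ 2 / rden m].
Proof. by have [em om] := avoid_odd m; apply: avoid_step_even. Qed.

(** In complex form, beta_(2m+2) = i x alpha_(2m+2)^2 conj(beta_(2m+1)), where
    beta_(2m+1) is purely imaginary. *)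
Lemma once_step_even m : p m.*2.+1 = 0 ->
  p m.*2.+2 = x * q m.*2.+1 * r m.+1 ^+ 2 / rden m ^+ 2 * (1 - (x * r m.+1) ^+ 2) /\
  q m.*2.+2 = x * q m.*2.+1 * r m.+1 ^+ 2 / rden m ^+ 2 * (2 * x * r m.+1).
Proof.
move=> pm; have [em om] := avoid_odd m; have [nzD em' om'] := avoid_even m.
have Rinv := r_inv m; set R := r m.+1 in Rinv em' om' *; set z := q m.*2.+1.
have pE : p m.*2.+2 = R * (x * z * e m.*2.+2) - (x * R) * q m.*2.+2.
  rewrite [LHS](scaled_solve (c := x * z * e m.*2.+2 - x * q m.*2.+2) Rinv); first by ring.
  by rewrite mulrBr mulr1 {1}pS pm em om -/z; ring.
have qE : q m.*2.+2 = R * (x * z * o m.*2.+2) + (x * R) * p m.*2.+2.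
  rewrite [LHS](scaled_solve (c := x * z * o m.*2.+2 + x * p m.*2.+2) Rinv); first by ring.
  by rewrite mulrBr mulr1 {1}qS pm em om -/z; ring.
have [-> ->] := rotation_system nzD pE qE.
by rewrite em' om' -/R -/(rden m); split; field.
Qed.

(** Over two steps the factors 1 + i x r_(m+1) and its conjugate cancel, which is
    why only [r m.+1] remains. *)
Lemma once_step_odd m : p m.*2.+1 = 0 ->
  p m.*2.+3 = 0 /\ q m.*2.+3 = x ^+ 2 * r m.+1 ^+ 2 * q m.*2.+1.
Proof.
move=> pm; have [pm' qm'] := once_step_even pm.
have [nzD em om] := avoid_even m; have /= [em' om'] := avoid_odd m.+1.
set R := r m.+1 in pm' qm' em om em' om' *; set z := q m.*2.+1 in pm' qm' *.
have dd : (1 - x * o m.*2.+2) * rden m = 1.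
  by rewrite om /rden -/R; field; rewrite -/(rden m).
have pE : p m.*2.+3 = x ^+ 3 * R ^+ 3 * z - (x * R) * q m.*2.+3.
  rewrite [LHS](scaled_solve (c := x * (q m.*2.+2 - x * R * p m.*2.+2)
                              - x * e m.*2.+2 * q m.*2.+3) dd).
    by rewrite em pm' qm' /rden -/R; field; rewrite -/(rden m).
  by rewrite mulrBr mulr1 {1}pS em' om' -/R; ring.
have qE : q m.*2.+3 = x ^+ 2 * R ^+ 2 * z + (x * R) * p m.*2.+3.
  rewrite [LHS](scaled_solve (c := x * (x * R * q m.*2.+2 + p m.*2.+2)
                              + x * e m.*2.+2 * p m.*2.+3) dd).
    by rewrite em pm' qm' /rden -/R; field; rewrite -/(rden m).
  by rewrite mulrBr mulr1 {1}qS em' om' -/R; ring.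
have [-> ->] := rotation_system nzD pE qE.
by split; rewrite /rden -/R; field; rewrite -/(rden m).
Qed.

Hypotheses (nz2 : 2 != 0 :> F) (nzx : x != 0).

Lemma once_odd m : p m.*2.+1 = 0 /\ q m.*2.+1 = x / Uval m (1 / (2 * x)) ^+ 2.
Proof.
elim: m => [|m [pm qm]].
  by rewrite p1 q1 /Uval /= hornerE expr1n divr1.
have [-> ->] := once_step_odd pm; split=> //; rewrite qm.
have [nzu ->] := Uval_ratio nz2 nzx r0 rS m.
have [nzu' _] := Uval_ratio nz2 nzx r0 rS m.+1.
by field; rewrite nzu nzu' nzx.
Qed.

Lemma signed_odd m : p m.*2.+1 + q m.*2.+1 = x / Uval m (1 / (2 * x)) ^+ 2.
Proof. by have [-> ->] := once_odd m; rewrite add0r. Qed.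

Lemma signed_even m : let R := chebR m.+1 x in
  p m.*2.+2 + q m.*2.+2 =
  x ^+ 2 * R ^+ 2 / ((1 + x ^+ 2 * R ^+ 2) ^+ 2 * Uval m (1 / (2 * x)) ^+ 2)
    * (1 + 2 * x * R - x ^+ 2 * R ^+ 2).
Proof.
have [nzu rE] := Uval_ratio nz2 nzx r0 rS m.
rewrite /chebR -rE; have [pm qm] := once_odd m; have [nzD _ _] := avoid_even m.
have [-> ->] := once_step_even pm; rewrite qm.
rewrite -exprMn -/(rden m); field.
by rewrite nzu nzD.
Qed.

End Signed.

(** The recurrence multiplies b_k by x a_(k+1)^2, and s a_(k+1) is the ratio of
    the consecutive values U_k and U_(k+1). *)
Lemma unsigned_once (F : fieldType) (s : F) (a b : nat -> F) :
  2 != 0 :> F -> s != 0 ->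
  a 0%N = 0 -> (forall k, a k.+1 = 1 + s ^+ 2 * (a k * a k.+1)) ->
  b 1%N = s ^+ 2 ->
  (forall k, b k.+2 = s ^+ 2 * (b k.+1 * a k.+2 + a k.+1 * b k.+2)) ->
  forall k, b k.+1 = 1 / Uval k.+1 (1 / (2 * s)) ^+ 2.
Proof.
move=> nz2 nzs a0 aS b1 bS; elim=> [|k IHk].
  by rewrite b1 /Uval /= !hornerE /=; field; rewrite nz2 nzs oner_neq0.
have [nzu aE] := Uval_ratio nz2 nzs a0 aS k.+1.
have [nzu' _] := Uval_ratio nz2 nzs a0 aS k.+2.
have inv := r_inv aS k.+1.
rewrite [LHS](scaled_solve (c := s ^+ 2 * b k.+1 * a k.+2) inv).
  by rewrite IHk aE; field; rewrite nzu nzu' nzs.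
by rewrite mulrBr mulr1 {1}bS; ring.
Qed.

(** * The generating functions of the theorem *)

Lemma card_contains_exactly n k r (P : pred (seq nat)) (pred_pi : pred 'S_n) :
  (forall pi : 'S_n, pred_pi pi = P (word pi)) ->
  #|[set pi : 'S_n | [&& pred_pi pi, avoids pat132 pi &
      contains_exactly r (increasing k) pi]]|%:R =
  \sum_(w <- Av132 n) (P w && (chains 0 k w == r))%:R :> rat.
Proof.
move=> PE; pose Q w := [&& P w, av132 w & chains 0 k w == r].
have -> : [set pi : 'S_n | [&& pred_pi pi, avoids pat132 pi &
    contains_exactly r (increasing k) pi]] = [set pi : 'S_n | Q (word pi)].
  apply/setP => pi; rewrite !inE PE avoids_pat132 /contains_exactly.
  by rewrite card_occurrences_increasing.
rewrite card_words -sum1_count big_mkcond natr_sum /Av132 big_filter [RHS]big_mkcond.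
by apply: eq_bigr => w _; rewrite /Q; case: (P w) (av132 w) (_ == _) => [] [] [].
Qed.

Lemma even_odd_gf k r :
  even_gf (increasing k) r + odd_gf (increasing k) r = chain_series false k r /\
  even_gf (increasing k) r - odd_gf (increasing k) r = chain_series true k r.
Proof.
have evenE n : even_gf (increasing k) r n =
    \sum_(w <- Av132 n) (~~ odd (inversions w) && (chains 0 k w == r))%:R.
  by apply: card_contains_exactly => pi; rewrite odd_perm_inversions.
have oddE n : odd_gf (increasing k) r n =
    \sum_(w <- Av132 n) (odd (inversions w) && (chains 0 k w == r))%:R.
  by apply: card_contains_exactly => pi; rewrite odd_perm_inversions.
split; apply: fpsP => n.
  rewrite fps_addE evenE oddE -big_split; apply: eq_bigr => w _.
  by rewrite /sgn /= mul1r; case: odd; rewrite /= ?addr0 ?add0r.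
rewrite [LHS](_ : _ = even_gf (increasing k) r n - odd_gf (increasing k) r n) //.
rewrite evenE oddE -sumrB; apply: eq_bigr => w _.
by rewrite /sgn /=; case: odd; rewrite /= ?subr0 ?sub0r ?mulN1r ?mul1r.
Qed.

Lemma at_x_unsigned k :
  at_x (chain_series false k.+1 1) = 1 / Uval k.+1 (1 / (2 * sqrtx)) ^+ 2.
Proof.
apply: (unsigned_once (a := fun j => at_x (chain_series false j 0))
                      (b := fun j => at_x (chain_series false j 1))).
- exact: laurent2_neq0.
- exact: sqrtx_neq0.
- by rewrite chain_series_avoid0 at_x0.
- by move=> j; rewrite {1}chain_series_avoid skew_mul_false at_xD at_x1 !at_xM at_xX.
- by rewrite chain_series_once1 at_xX.
by move=> j; rewrite {1}chain_series_once !skew_mul_false at_xM at_xD !at_xM at_xX.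
Qed.

Lemma at_x_signed m :
  let x : laurent := varx in let R := chebR m.+1 x in
  at_x (chain_series true m.*2.+1 1) = x / Uval m (1 / (2 * x)) ^+ 2 /\
  at_x (chain_series true m.*2.+2 1) =
    x ^+ 2 * R ^+ 2 / ((1 + x ^+ 2 * R ^+ 2) ^+ 2 * Uval m (1 / (2 * x)) ^+ 2)
      * (1 + 2 * x * R - x ^+ 2 * R ^+ 2).
Proof.
move=> x R.
(* One square comes from [fps_sq]: [r k] is R_k(x^2), not R_k(x). *)
pose r k := at_x (fps_sq (chain_series false k 0)).
pose e k := at_x (even_part (chain_series true k 0)).
pose o k := at_x (odd_part (chain_series true k 0)).
pose p k := at_x (even_part (chain_series true k 1)).
pose q k := at_x (odd_part (chain_series true k 1)).
have r0 : r 0%N = 0 by rewrite /r chain_series_avoid0 fps_sq0 at_x0.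
have rS k : r k.+1 = 1 + x ^+ 2 * (r k * r k.+1).
  rewrite {1}/r chain_series_avoid skew_mul_false fps_sqD fps_sq1 at_xD at_x1.
  by rewrite !fps_sqM fps_sqX !at_xM at_xX.
have zero_parts : even_part 0 = 0 /\ odd_part 0 = 0.
  by split; apply: fpsP => n /=; case: ifP.
have e0 : e 0%N = 0 by rewrite /e chain_series_avoid0 zero_parts.1 at_x0.
have o0 : o 0%N = 0 by rewrite /o chain_series_avoid0 zero_parts.2 at_x0.
have eS k : e k.+1 = 1 + x * (o k * e k.+1 - e k * o k.+1).
  rewrite {1}/e chain_series_avoid even_partD even_part1 even_part_skew_mul.
  by rewrite at_xD at_x1 at_xM at_xX at_xD at_xN !at_xM.
have oS k : o k.+1 = x * (o k * o k.+1 + e k * e k.+1).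
  rewrite {1}/o chain_series_avoid odd_partD odd_part1 add0r odd_part_skew_mul.
  by rewrite at_xM at_xX at_xD !at_xM.
have p1 : p 1%N = 0 by rewrite /p chain_series_once1 even_partX at_x0.
have q1 : q 1%N = x by rewrite /q chain_series_once1 odd_partX at_xX.
have pS k : p k.+2 =
    x * (q k.+1 * e k.+2 - p k.+1 * o k.+2 + (o k.+1 * p k.+2 - e k.+1 * q k.+2)).
  rewrite {1}/p chain_series_once mulrDr even_partD !even_part_skew_mul -mulrDr.
  by rewrite at_xM at_xX !at_xD !at_xN !at_xM.
have qS k : q k.+2 =
    x * (q k.+1 * o k.+2 + p k.+1 * e k.+2 + (o k.+1 * q k.+2 + e k.+1 * p k.+2)).
  rewrite {1}/q chain_series_once mulrDr odd_partD !odd_part_skew_mul -mulrDr.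
  by rewrite at_xM at_xX !at_xD !at_xM.
have nzx : x != 0 by rewrite expf_neq0 // sqrtx_neq0.
have partsE k : at_x (chain_series true k 1) = p k + q k.
  by rewrite -at_xD even_odd_part.
have nz2 := laurent2_neq0.
rewrite !partsE; split.
  exact: (signed_odd r0 rS e0 o0 eS oS p1 q1 pS qS nz2 nzx).
exact: (signed_even r0 rS e0 o0 eS oS p1 q1 pS qS nz2 nzx).
Qed.

Lemma half_sum_diff (F : fieldType) (a b c d : F) : 2 != 0 :> F ->
  a + b = c -> a - b = d -> a = 1 / 2 * (c + d) /\ b = 1 / 2 * (c - d).
Proof. by move=> nz2 <- <-; split; field. Qed.

Lemma even_odd_at_x k :
  let U : laurent := at_x (chain_series false k 1) in
  let V := at_x (chain_series true k 1) in
  at_x (even_gf (increasing k) 1) = 1 / 2 * (U + V) /\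
  at_x (odd_gf (increasing k) 1) = 1 / 2 * (U - V).
Proof.
have [sumE diffE] := even_odd_gf k 1; apply: half_sum_diff.
- exact: laurent2_neq0.
- by rewrite -at_xD sumE.
- by rewrite -at_xN -at_xD diffE.
Qed.

Theorem corollary3p6 (m : nat) :
  let s : laurent := sqrtx in
  let x : laurent := varx in
  let R : laurent := chebR m.+1 x in
  [/\ at_x (even_gf (increasing (2 * m + 1)) 1) =
        1 / 2 * (1 / Uval (2 * m + 1) (1 / (2 * s)) ^+ 2
                 + x / Uval m (1 / (2 * x)) ^+ 2),
      at_x (odd_gf (increasing (2 * m + 1)) 1) =
        1 / 2 * (1 / Uval (2 * m + 1) (1 / (2 * s)) ^+ 2
                 - x / Uval m (1 / (2 * x)) ^+ 2),
      at_x (even_gf (increasing (2 * m + 2)) 1) =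
        1 / 2 * (1 / Uval (2 * m + 2) (1 / (2 * s)) ^+ 2
                 + x ^+ 2 * R ^+ 2
                   / ((1 + x ^+ 2 * R ^+ 2) ^+ 2 * Uval m (1 / (2 * x)) ^+ 2)
                   * (1 + 2 * x * R - x ^+ 2 * R ^+ 2))
    & at_x (odd_gf (increasing (2 * m + 2)) 1) =
        1 / 2 * (1 / Uval (2 * m + 2) (1 / (2 * s)) ^+ 2
                 - x ^+ 2 * R ^+ 2
                   / ((1 + x ^+ 2 * R ^+ 2) ^+ 2 * Uval m (1 / (2 * x)) ^+ 2)
                   * (1 + 2 * x * R - x ^+ 2 * R ^+ 2))].
Proof.
move=> s x R; have [] := at_x_signed m; rewrite -/x -/R => sgn_odd sgn_even.
have [e1 o1] := even_odd_at_x (2 * m + 1); have [e2 o2] := even_odd_at_x (2 * m + 2).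
have idx1 : (2 * m + 1)%N = m.*2.+1 by rewrite addn1 mul2n.
have idx2 : (2 * m + 2)%N = m.*2.+2 by rewrite addn2 mul2n.
rewrite e1 o1 e2 o2 idx1 idx2 !at_x_unsigned sgn_odd sgn_even.
by [].
Qed.
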